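(* Let $\Sigma$ be a signature, $\mathbf{K}$ a class of $\Sigma$-structures closed under subalgebras and $(Co_{\mathbf{K}},i)$ an equational filter pair having the theory lifting property. If $\mathbf{K}$ has the amalgamation property, then the logic associated to $(Co_{\mathbf{K}},i)$ has the Craig entailment interpolation property.
   Context: $Fm(X)$ is the absolutely free $\Sigma$-structure (formula algebra) on a set $X$ of variables; for $Z\subseteq X$ regard $Fm(Z)\subseteq Fm(X)$. A quasivariety is a class of $\Sigma$-structures axiomatizable by quasi-identities. $Co_{\mathbf{K}}(A)$ is the lattice of congruences $\theta$ on $A$ with $A/\theta\in\mathbf{K}$, ordered by inclusion. An equational filter pair is a pair $(Co_{\mathbf{K}},i)$ with $\mathbf{K}$ a quasivariety and $i_A:Co_{\mathbf{K}}(A)\to\mathcal{P}(A)$, $i_A(\theta)=\{a\in A\mid\langle\delta^A(a),\epsilon^A(a)\rangle\in\theta$ for all $\delta\approx\epsilon\in\tau\}$ for every $\Sigma$-structure $A$, where $\tau$ is a fixed finite set of equations in at most one variable. The associated logic with set of variables $X$, $(\Sigma,\vdash^X)$: for $\Gamma\cup\{\varphi\}\subseteq Fm(X)$, $\Gamma\vdash^X\varphi$ iff for all $\theta\in Co_{\mathbf{K}}(Fm(X))$, $\Gamma\subseteq i_{Fm(X)}(\theta)$ implies $\varphi\in i_{Fm(X)}(\theta)$. A theory in $Fm(X)$ is a $\vdash^X$-closed subset (equivalently, a set in the image of $i_{Fm(X)}$). Theory lifting property: for all sets $X,Y$ with $Z:=X\cap Y\neq\emptyset$ and every theory $T\subseteq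 Fm(X)$, putting $T'':=T\cap Fm(Z)$ and letting $T'\subseteq Fm(Y)$ be the smallest theory in $Fm(Y)$ containing $T''$, there exist $\theta_T\in Co_{\mathbf{K}}(Fm(X))$, $\theta_{T''}\in Co_{\mathbf{K}}(Fm(Z))$, $\theta_{T'}\in Co_{\mathbf{K}}(Fm(Y))$ with (a) $T=i(\theta_T)$, $T'=i(\theta_{T'})$, $T''=i(\theta_{T''})$, and (b) $\theta_T\cap Fm(Z)^2=\theta_{T''}=\theta_{T'}\cap Fm(Z)^2$. Amalgamation property of $\mathbf{K}$: for all $A,B,C\in\mathbf{K}$ and injective homomorphisms $i_B:A\to B$, $i_C:A\to C$ there are $D\in\mathbf{K}$ and injective homomorphisms $e_B:B\to D$, $e_C:C\to D$ with $e_B\circ i_B=e_C\circ i_C$. Craig entailment interpolation property of a logic: for every set of formulas $\Gamma$ and every formula $\varphi$, if $\Gamma\vdash\varphi$ then there is a set of formulas $\Gamma'$ with variables in $var(\Gamma)\cap var(\varphi)$ such that $\Gamma\vdash\gamma'$ for all $\gamma'\in\Gamma'$ and $\Gamma'\vdash\varphi$. Here $var$ denotes the set of variables occurring. *)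

(* Defs.v *)
From mathcomp Require Import all_boot.
From mathcomp Require Import boolp classical_sets functions cardinality.

Set Implicit Arguments.
Unset Strict Implicit.
Unset Printing Implicit Defensive.

Local Open Scope classical_set_scope.

Record signature := Signature { op : Type; arity : op -> nat }.

(* Carriers may be empty: no inhabitance is required. *)
Record structure (S : signature) := Structure {
  carrier :> Type;
  interp : forall f : op S, ('I_(arity f) -> carrier) -> carrier }.

Definition is_hom (S : signature) (A B : structure S) (h : A -> B) : Prop :=
  forall (f : op S) (a : 'I_(arity f) -> A), h (interp a) = interp (h \o a).

Definition is_embedding (S : signature) (A B : structure S) (h : A -> B) : Prop :=
  is_hom h /\ injective h.

Inductive term (S : signature) (V : Type) : Type :=
  | Var of V
  | App (f : op S) of ('I_(arity f) -> term S V).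

Arguments Var {S V}.
Arguments App {S V}.

Definition Fm (S : signature) (V : Type) : structure S :=
  @Structure S (term S V) App.

Fixpoint eval (S : signature) (V : Type) (A : structure S) (v : V -> A)
    (t : term S V) : A :=
  match t with
  | Var x => v x
  | App f a => interp (fun i => eval v (a i))
  end.

Fixpoint vars (S : signature) (V : Type) (t : term S V) : set V :=
  match t with
  | Var x => [set x]
  | App f a => \bigcup_i vars (a i)
  end.

Definition vars_set (S : signature) (V : Type) (G : set (Fm S V)) : set V :=
  \bigcup_(t in G) vars t.

(* The inclusion of [Fm Z] in [Fm X]: a set [Z : set V] is coerced to the type
   [set_type Z] of its elements, and [subfun ZX : Z -> X] is the inclusion. *)
Definition Fm_incl (S : signature) (V : Type) (Z X : set V) (ZX : Z `<=` X) :
    Fm S Z -> Fm S X :=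
  eval (A := Fm S X) (Var \o subfun ZX).

Record congruence (S : signature) (A : structure S) := Congruence {
  cong :> A -> A -> Prop;
  cong_refl : forall a, cong a a;
  cong_sym : forall a b, cong a b -> cong b a;
  cong_trans : forall a b c, cong a b -> cong b c -> cong a c;
  cong_interp : forall (f : op S) (a b : 'I_(arity f) -> A),
    (forall i, cong (a i) (b i)) -> cong (interp a) (interp b) }.

Section Quotient.
Variables (S : signature) (A : structure S) (theta : congruence A).

Definition quot_carrier : Type := {c : set A | exists a, c = theta a}.

Definition quot_pi (a : A) : quot_carrier :=
  exist _ (theta a : set A) (ex_intro _ a erefl).

Definition quot_repr (c : quot_carrier) : A := projT1 (cid (projT2 c)).

Definition quot : structure S :=
  @Structure S quot_carrier (fun f c => quot_pi (interp (quot_repr \o c))).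

Lemma quot_piP (a b : A) : quot_pi a = quot_pi b <-> theta a b.
Proof.
split=> [/(congr1 (fun c : quot_carrier => projT1 c b)) /= -> | ab].
  exact: cong_refl.
rewrite /quot_pi; apply: eq_exist; apply/funext => c; apply/propext; split.
  by apply: cong_trans; apply: cong_sym.
exact: cong_trans.
Qed.

Lemma quot_reprK (c : quot_carrier) : quot_pi (quot_repr c) = c.
Proof.
case: c => c cP; rewrite /quot_pi /quot_repr /=.
by apply: eq_exist; case: cid.
Qed.

Lemma quot_pi_hom : is_hom (B := quot) quot_pi.
Proof.
move=> f a; apply/quot_piP/cong_interp => i.
by apply/quot_piP; rewrite quot_reprK.
Qed.

End Quotient.

Definition class (S : signature) := structure S -> Prop.

Definition closed_under_ops (S : signature) (A : structure S) (P : set A) : Prop :=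
  forall (f : op S) (a : 'I_(arity f) -> A), (forall i, P (a i)) -> P (interp a).

Definition substructure (S : signature) (A : structure S) (P : set A)
    (clP : closed_under_ops P) : structure S :=
  @Structure S {a : A | P a}
    (fun f a => exist P (interp (fun i => sval (a i)))
                  (clP f _ (fun i => svalP (a i)))).

Definition closed_under_subalgebras (S : signature) (K : class S) : Prop :=
  forall (A : structure S) (P : set A) (clP : closed_under_ops P),
    K A -> K (substructure clP).

Definition equation (S : signature) (V : Type) : Type := (Fm S V * Fm S V)%type.

Definition eq_holds (S : signature) (V : Type) (A : structure S) (v : V -> A)
    (e : equation S V) : Prop :=
  eval v e.1 = eval v e.2.

Record quasi_identity (S : signature) := QuasiIdentity {
  premises : set (equation S nat);
  premises_finite : finite_set premises;
  conclusion : equation S nat }.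

Definition satisfies (S : signature) (A : structure S) (q : quasi_identity S) : Prop :=
  forall v : nat -> A,
    (forall e, premises q e -> eq_holds v e) -> eq_holds v (conclusion q).

Definition quasivariety (S : signature) (K : class S) : Prop :=
  exists Q : set (quasi_identity S),
    forall A : structure S, K A <-> (forall q, Q q -> satisfies A q).

Definition Co (S : signature) (K : class S) (A : structure S) : set (congruence A) :=
  [set theta | K (quot theta)].

(* The map i_A; equations in at most one variable are equations over [unit]. *)
Definition filter_of (S : signature) (tau : set (equation S unit))
    (A : structure S) (theta : congruence A) : set A :=
  [set a | forall e, tau e ->
     theta (eval (fun=> a) e.1) (eval (fun=> a) e.2)].

Definition equational_filter_pair (S : signature) (K : class S)
    (tau : set (equation S unit)) : Prop :=
  quasivariety K /\ finite_set tau.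

Definition entails (S : signature) (K : class S) (tau : set (equation S unit))
    (V : Type) (G : set (Fm S V)) (phi : Fm S V) : Prop :=
  forall theta : congruence (Fm S V), Co K theta ->
    G `<=` filter_of tau theta -> filter_of tau theta phi.

Definition is_theory (S : signature) (K : class S) (tau : set (equation S unit))
    (V : Type) (T : set (Fm S V)) : Prop :=
  forall phi, entails K tau T phi -> T phi.

Definition theory_lifting (S : signature) (K : class S)
    (tau : set (equation S unit)) : Prop :=
  forall (V : Type) (X Y : set V), X `&` Y !=set0 ->
  let Z := X `&` Y in
  let ZX : Fm S Z -> Fm S X := Fm_incl (@subIsetl V X Y) in
  let ZY : Fm S Z -> Fm S Y := Fm_incl (@subIsetr V X Y) in
  forall T : set (Fm S X), is_theory K tau T ->
  let T'' : set (Fm S Z) := ZX @^-1` T in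
  let T' : set (Fm S Y) := smallest (@is_theory S K tau Y) (ZY @` T'') in
  exists (thetaT : congruence (Fm S X)) (thetaT'' : congruence (Fm S Z))
         (thetaT' : congruence (Fm S Y)),
    [/\ Co K thetaT, Co K thetaT'' & Co K thetaT'] /\
    [/\ T = filter_of tau thetaT, T' = filter_of tau thetaT'
      & T'' = filter_of tau thetaT''] /\
    (forall s t : Fm S Z, thetaT (ZX s) (ZX t) <-> thetaT'' s t) /\
    (forall s t : Fm S Z, thetaT'' s t <-> thetaT' (ZY s) (ZY t)).

Definition amalgamation (S : signature) (K : class S) : Prop :=
  forall (A B C : structure S) (iB : A -> B) (iC : A -> C),
    K A -> K B -> K C -> is_embedding iB -> is_embedding iC ->
    exists (D : structure S) (eB : B -> D) (eC : C -> D),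
      [/\ K D, is_embedding eB, is_embedding eC & eB \o iB = eC \o iC].

Definition craig_entailment_interpolation (S : signature) (V : Type)
    (ent : set (Fm S V) -> Fm S V -> Prop) : Prop :=
  forall (G : set (Fm S V)) (phi : Fm S V), ent G phi ->
  exists G' : set (Fm S V),
    [/\ vars_set G' `<=` vars_set G `&` vars phi,
        forall gamma', G' gamma' -> ent G gamma' & ent G' phi].

(* Main.v *)
Require Import Defs.
From mathcomp Require Import all_boot.
From mathcomp Require Import boolp functions.
From mathcomp Require Import classical_sets.

(** Validity of [phi] in the filter of a congruence means that the class of
    [phi] solves the equations [tau], so that [|-] is consequence over the
    valuations in members of [K].  Let [X] and [Y] be the variables of [G] and
    [phi].  When [X] and [Y] meet, the interpolant is the trace [T''] on
    [Fm (X `&` Y)] of the theory [T] generated by [G] in [Fm X].  The congruences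
    given by theory lifting make [Fm (X `&` Y) / theta_T''] a common substructure
    of [Fm X / theta_T] and [Fm Y / theta_T'], where [T'] is generated by [T''] in
    [Fm Y].  A valuation into an amalgam of the two turns [G |- phi] into
    [phi \in T'].

    When [X] and [Y] are disjoint, theory lifting does not apply.  If there is a
    closed term, a fresh variable is added to both sides and replaced by this
    term in the interpolant.  Otherwise [Fm set0] is the empty structure, which
    lies in [K], and amalgamating over it a one-element model of [G] with an
    arbitrary model shows that [phi] is a theorem. *)

Set Implicit Arguments.
Unset Strict Implicit.
Unset Printing Implicit Defensive.

Local Open Scope classical_set_scope.

(** * Terms, substitutions and renamings *)

Section Terms.
Variable S : signature.

Lemma hom_eval (V : Type) (A B : structure S) (h : A -> B) (v : V -> A)
    (t : term S V) : is_hom h -> h (eval v t) = eval (h \o v) t.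
Proof.
move=> hh; elim: t => [//|f a IH] /=; rewrite hh; congr interp.
by apply/funext => i /=.
Qed.

Lemma eval_hom (V : Type) (A : structure S) (v : V -> A) :
  is_hom (A := Fm S V) (eval v).
Proof. by []. Qed.

Lemma eval_eval (V W : Type) (A : structure S) (v : W -> A)
    (s : V -> Fm S W) (t : term S V) :
  eval v (eval s t) = eval (eval v \o s) t.
Proof. by rewrite (hom_eval _ _ (eval_hom v)). Qed.

Lemma eval_Var (V : Type) (t : term S V) : eval (A := Fm S V) Var t = t.
Proof. by elim: t => [//|f a IH] /=; congr App; apply/funext. Qed.

(** With [f := val] this places [Fm S X] inside [Fm S V], where terms over different sets of
    variables can be compared. *)
Definition rename (V W : Type) (f : V -> W) : Fm S V -> Fm S W :=
  eval (A := Fm S W) (Var \o f).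

Lemma vars_eval (V W : Type) (s : V -> Fm S W) (t : term S V) :
  vars (eval s t) = \bigcup_(x in vars t) vars (s x).
Proof.
elim: t => [x|f a IH] /=; first by rewrite bigcup_set1.
apply/seteqP; split=> w /=.
  move=> [i _]; rewrite IH => -[x xi wx].
  by exists x => //; exists i.
by move=> [x [i _ xi] wx]; exists i => //; rewrite IH; exists x.
Qed.

Lemma rename_val_vars (V : Type) (X : set V) (t : Fm S X) :
  vars (rename val t) `<=` X.
Proof. by rewrite vars_eval => _ [x _ ->]; exact: set_valP. Qed.

Lemma rename_val_surj (V : Type) (X : set V) (t : Fm S V) :
  vars t `<=` X -> exists s : Fm S X, rename val s = t.
Proof.
elim: t => [x|f a IH] /= tX.
  by exists (Var (SigSub (mem_set (tX x erefl)))).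
have /choice[s sE] : forall i, exists s : Fm S X, rename val s = a i.
  by move=> i; apply: IH => x xi; apply: tX; exists i.
by exists (App f s) => /=; congr App; apply/funext.
Qed.

Lemma rename_val_Fm_incl (V : Type) (Z X : set V) (ZX : Z `<=` X) (t : Fm S Z) :
  rename val (Fm_incl ZX t) = rename val t.
Proof. exact: eval_eval. Qed.

End Terms.

(** * Solutions of [tau] in a structure *)

Section Solutions.
Variables (S : signature) (tau : set (equation S unit)).

(** The filter of the identity congruence; every filter is the preimage of such a set under a
    quotient map. *)
Definition solutions (A : structure S) : set A :=
  [set a | forall e, tau e -> eval (fun=> a) e.1 = eval (fun=> a) e.2].

Lemma hom_eval1 (A B : structure S) (h : A -> B) (a : A) (t : Fm S unit) :
  is_hom h -> h (eval (fun=> a) t) = eval (fun=> h a) t.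
Proof. exact: hom_eval. Qed.

Lemma solutions_embedding (A B : structure S) (h : A -> B) (a : A) :
  is_embedding h -> solutions (h a) <-> solutions a.
Proof.
move=> [hh hi]; split=> sa e /sa; rewrite -!hom_eval1 //; first exact: hi.
by move=> ->.
Qed.

Lemma solutions_kernel (A B : structure S) (h : A -> B) (theta : congruence A)
    (a : A) : is_hom h -> (forall x y, theta x y <-> h x = h y) ->
  filter_of tau theta a <-> solutions (h a).
Proof.
move=> hh hP; split=> sa e /sa; first by rewrite hP !hom_eval1.
by rewrite hP !hom_eval1.
Qed.

Lemma solutions_quot (A : structure S) (theta : congruence A) (a : A) :
  filter_of tau theta a <-> solutions (A := quot theta) (quot_pi theta a).
Proof.
apply: solutions_kernel; first exact: quot_pi_hom.
by move=> x y; apply: iff_sym; exact: quot_piP.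
Qed.

End Solutions.

(** * Kernels and maps between quotients *)

Section Congruences.
Variable S : signature.

Lemma kernel_interp (A B : structure S) (h : A -> B) : is_hom h ->
  forall (f : op S) (a b : 'I_(arity f) -> A),
    (forall i, h (a i) = h (b i)) -> h (interp a) = h (interp b).
Proof. by move=> hh f a b ab; rewrite !hh; congr interp; apply/funext. Qed.

Definition kernel (A B : structure S) (h : A -> B) (hh : is_hom h) :
    congruence A :=
  @Congruence S A (fun a b => h a = h b) (fun=> erefl)
    (fun _ _ => @esym _ _ _) (fun _ _ _ => @etrans _ _ _ _)
    (kernel_interp hh).

Lemma eval_quot_pi (V : Type) (theta : congruence (Fm S V)) (t : Fm S V) :
  eval (A := quot theta) (quot_pi theta \o Var) t = quot_pi theta t.
Proof.
by rewrite -(hom_eval _ _ (@quot_pi_hom _ _ theta)) eval_Var.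
Qed.

(** Since [theta] is the preimage of [theta'] under [h], the map induced on classes is both well
    defined and injective. *)
Lemma quot_map_embedding (A B : structure S) (theta : congruence A)
    (theta' : congruence B) (h : A -> B) :
  is_hom h -> (forall a b, theta' (h a) (h b) <-> theta a b) ->
  exists2 k : quot theta -> quot theta',
    is_embedding k & forall a, k (quot_pi theta a) = quot_pi theta' (h a).
Proof.
move=> hh hP; exists (fun c => quot_pi theta' (h (quot_repr c))); last first.
  by move=> a; apply/quot_piP; rewrite hP; apply/quot_piP; rewrite quot_reprK.
split=> [f c|c d /quot_piP]; last first.
  by rewrite hP => /quot_piP; rewrite !quot_reprK.
rewrite /=; transitivity (quot_pi theta' (h (interp (@quot_repr _ _ theta \o c)))).
  by apply/quot_piP/hP/quot_piP; rewrite quot_reprK.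
by rewrite hh (quot_pi_hom theta').
Qed.

Lemma quot_kernel_embedding (A B : structure S) (h : A -> B) (hh : is_hom h) :
  is_embedding (fun c : quot (kernel hh) => h (quot_repr c)).
Proof.
split=> [f c|c d cd]; last first.
  by rewrite -(quot_reprK c) -(quot_reprK d); apply/quot_piP.
transitivity (h (interp (@quot_repr _ _ (kernel hh) \o c))); last exact: hh.
suff : kernel hh (quot_repr (interp c)) (interp (@quot_repr _ _ _ \o c)) by [].
by apply/quot_piP; rewrite quot_reprK.
Qed.

End Congruences.

(** * Consequence over valuations in a quasivariety *)

Section Quasivariety.
Variables (S : signature) (K : class S).
Hypothesis K_qv : quasivariety K.

(** A homomorphism preserves the premises of a quasi-identity, and injectivity reflects its
    conclusion. *)
Lemma quasivariety_embedding (A B : structure S) (h : A -> B) :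
  is_embedding h -> K B -> K A.
Proof.
case: K_qv => Q KQ [hh hi] /KQ KB; apply/KQ => q Qq v prem.
apply: hi; rewrite !hom_eval //; apply: KB => // e /prem.
by rewrite /eq_holds -!hom_eval // => ->.
Qed.

(** The hypothesis also admits the empty structure. *)
Lemma quasivariety_trivial (A : structure S) : (forall a b : A, a = b) -> K A.
Proof. by case: K_qv => Q KQ A1; apply/KQ => q _ v _; exact: A1. Qed.

Variable tau : set (equation S unit).

(** The kernel of a valuation in [D] lies in [Co K], because the quotient embeds in [D]; conversely,
    [theta] yields the valuation sending each variable to its class. *)
Lemma entailsP (V : Type) (G : set (Fm S V)) (phi : Fm S V) :
  entails K tau G phi <->
  forall (D : structure S) (v : V -> D), K D ->
    (forall g, G g -> solutions tau (eval v g)) -> solutions tau (eval v phi).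
Proof.
split=> [Gphi D v KD vG|Gphi theta Ktheta Gtheta].
  have hv := eval_hom v.
  rewrite -(@solutions_kernel _ _ _ _ _ (kernel hv)) //.
  apply: Gphi => [|g /vG].
    exact: quasivariety_embedding (quot_kernel_embedding hv) KD.
  by rewrite -(@solutions_kernel _ _ _ _ _ (kernel hv)).
rewrite solutions_quot -eval_quot_pi; apply: Gphi => // g /Gtheta.
by rewrite solutions_quot -eval_quot_pi.
Qed.

Lemma entails_subst (V W : Type) (s : V -> Fm S W) (G : set (Fm S V))
    (phi : Fm S V) :
  entails K tau G phi -> entails K tau (eval s @` G) (eval s phi).
Proof.
rewrite !entailsP => Gphi D v KD vG; rewrite eval_eval; apply: Gphi => // g Gg.
by rewrite -eval_eval; apply: vG; exists g.
Qed.

Arguments entails_subst [V W] s [G phi].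

Lemma entails_theory (V : Type) (G : set (Fm S V)) :
  is_theory K tau (entails K tau G).
Proof.
move=> phi Tphi theta Ktheta Gtheta; apply: (Tphi) => // t Gt.
exact: Gt.
Qed.

Lemma sub_entails (V : Type) (G : set (Fm S V)) : G `<=` entails K tau G.
Proof. by move=> g Gg theta _; apply. Qed.

Lemma entails_sub (V : Type) (G H : set (Fm S V)) (phi : Fm S V) :
  G `<=` H -> entails K tau G phi -> entails K tau H phi.
Proof. by move=> GH Gphi theta Kt Ht; apply: Gphi => // g /GH; exact: Ht. Qed.

(** * Gluing valuations in an amalgam, and interpolants *)

Hypothesis K_amalg : amalgamation K.

(** On shared variables [vB] and [vC] both come from [vA], so they agree in the amalgam and glue;
    embeddings preserve and reflect solutions of [tau]. *)
Lemma amalgam_valuation (V : Type) (X Y : set V) (A B C : structure S)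
    (iB : A -> B) (iC : A -> C) (vA : X `&` Y -> A) (vB : X -> B) (vC : Y -> C) :
  K A -> K B -> K C -> is_embedding iB -> is_embedding iC ->
  (forall z, iB (vA z) = vB (subfun (@subIsetl V X Y) z)) ->
  (forall z, iC (vA z) = vC (subfun (@subIsetr V X Y) z)) ->
  X `|` Y !=set0 ->
  exists (D : structure S) (v : V -> D), [/\ K D,
    forall s : Fm S X,
      solutions tau (eval v (rename val s)) <-> solutions tau (eval vB s)
  & forall s : Fm S Y,
      solutions tau (eval v (rename val s)) <-> solutions tau (eval vC s)].
Proof.
move=> KA KB KC eiB eiC vAB vAC [x0 x0XY].
have [D [eB [eC [KD eeB eeC comm]]]] := K_amalg KA KB KC eiB eiC.
have vX x : X x -> exists d : D,
    (forall x1 : X, val x1 = x -> d = eB (vB x1)) /\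
    (forall y1 : Y, val y1 = x -> d = eC (vC y1)).
  move=> Xx; exists (eB (vB (SigSub (mem_set Xx)))); split=> [x1 x1x|y1 y1x].
    by congr (eB (vB _)); exact: val_inj.
  have Zx : (X `&` Y) x by split=> //; rewrite -y1x; exact: set_valP.
  have := congr1 (@^~ (vA (SigSub (mem_set Zx)))) comm.
  rewrite /= vAB vAC => e.
  transitivity (eB (vB (subfun (@subIsetl V X Y) (SigSub (mem_set Zx))))).
    by congr (eB (vB _)); exact: val_inj.
  by rewrite e; congr (eC (vC _)); exact: val_inj.
have vXY x : (X `|` Y) x -> exists d : D,
    (forall x1 : X, val x1 = x -> d = eB (vB x1)) /\
    (forall y1 : Y, val y1 = x -> d = eC (vC y1)).
  have [/vX//|nXx [//|Yx]] := pselect (X x).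
  exists (eC (vC (SigSub (mem_set Yx)))); split=> [x1 x1x|y1 y1x].
    by case: nXx; rewrite -x1x; exact: set_valP.
  by congr (eC (vC _)); exact: val_inj.
have /choice[v vP] : forall x, exists d : D,
    (forall x1 : X, val x1 = x -> d = eB (vB x1)) /\
    (forall y1 : Y, val y1 = x -> d = eC (vC y1)).
  move=> x; have [/vXY//|nx] := pselect ((X `|` Y) x).
  (* Both conditions are vacuous here, so any element of [D] serves; the value at [x0] supplies
     one. *)
  have [d _] := vXY _ x0XY; exists d; split=> [x1|y1] e; case: nx.
    by left; rewrite -e; exact: set_valP.
  by right; rewrite -e; exact: set_valP.
have [hB hC] := (eeB.1, eeC.1).
exists D, v; split=> // s.
- rewrite eval_eval (_ : _ \o _ = eB \o vB); last first.
    by apply/funext => x; apply: (vP _).1.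
  by rewrite -hom_eval // solutions_embedding.
- rewrite eval_eval (_ : _ \o _ = eC \o vC); last first.
    by apply/funext => y; apply: (vP _).2.
  by rewrite -hom_eval // solutions_embedding.
Qed.

(** Only inclusions into [X] and [Y] are assumed, which leaves room for a common variable occurring
    in neither [G] nor [phi]. *)
Lemma interpolation_shared_var (V : Type) (X Y : set V) (G : set (Fm S V))
    (phi : Fm S V) :
  theory_lifting K tau -> X `&` Y !=set0 ->
  vars_set G `<=` X -> vars phi `<=` Y -> entails K tau G phi ->
  exists H : set (Fm S (X `&` Y)),
    (forall h, H h -> entails K tau G (rename val h)) /\
    entails K tau (rename val @` H) phi.
Proof.
move=> lifting XY0 GX phiY Gphi.
pose ZX : Fm S (X `&` Y) -> Fm S X := Fm_incl (@subIsetl V X Y).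
pose ZY : Fm S (X `&` Y) -> Fm S Y := Fm_incl (@subIsetr V X Y).
pose GS : set (Fm S X) := rename val @^-1` G.
pose T := entails K tau GS.
have := lifting V X Y XY0 T (@entails_theory _ _).
move=> [tT [tZ [tT' [[KT KZ KT'] [[TE T'E T''E] [ZXP ZYP]]]]]].
have [iX eX iXE] := quot_map_embedding (eval_hom _ : is_hom ZX) ZXP.
have [iY eY iYE] :=
  quot_map_embedding (eval_hom _ : is_hom ZY) (fun s t => iff_sym (ZYP s t)).
(* Under these valuations each term evaluates to its own class, so solving [tau] in the amalgam
   tests membership in [T] over [X] and in [T'] over [Y]. *)
have [] := @amalgam_valuation V X Y _ _ _ iX iY (quot_pi tZ \o Var)
  (quot_pi tT \o Var) (quot_pi tT' \o Var) KZ KT KT' eX eY.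
- by move=> z; rewrite /= iXE.
- by move=> z; rewrite /= iYE.
- by case: XY0 => x [Xx _]; exists x; left.
move=> D [v [KD vX vY]].
have [phi' phi'E] := rename_val_surj phiY.
have T'phi : filter_of tau tT' phi'.
  rewrite solutions_quot -eval_quot_pi -vY phi'E.
  apply: ((entailsP _ _).1 Gphi) => // g Gg.
  have [g' g'E] : exists g' : Fm S X, rename val g' = g.
    by apply: (@rename_val_surj _ _ X) => x xg; apply: GX; exists g.
  rewrite -g'E vX eval_quot_pi -solutions_quot.
  have : T g' by apply: sub_entails; rewrite /GS /= g'E.
  by rewrite TE.
exists (ZX @^-1` T); split=> [h|].
  rewrite -(rename_val_Fm_incl (@subIsetl V X Y) h) => Th.
  by apply: (entails_sub _ (entails_subst (Var \o val) Th)) => _ [g + <-].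
have {T'phi} : entails K tau (ZY @` (ZX @^-1` T)) phi'.
  (* The smallest theory is an intersection, used here at the theory of all consequences of the
     trace of [T]. *)
  move: T'phi; rewrite -T'E; apply; split; first exact: entails_theory.
  exact: sub_entails.
rewrite -phi'E => /(entails_subst (Var \o val)); apply: entails_sub.
move=> _ [_ [h Th <-] <-]; exists h => //.
by rewrite -[RHS]/(rename val (ZY h)) rename_val_Fm_incl.
Qed.

Lemma interpolation_closed_term (V : Type) (G : set (Fm S V)) (phi c : Fm S V) :
  theory_lifting K tau -> vars_set G `&` vars phi = set0 -> vars c = set0 ->
  entails K tau G phi ->
  exists H : set (Fm S V), [/\ vars_set H = set0,
    forall h, H h -> entails K tau G h & entails K tau H phi].
Proof.
move=> lifting XY0 c0 Gphi.
(* [None] is the fresh variable; [sigma] puts [c] in its place and undoes the renaming by [Some]. *)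
pose X : set (option V) := None |` (Some @` vars_set G).
pose Y : set (option V) := None |` (Some @` vars phi).
pose sigma (o : option V) : Fm S V := if o is Some x then Var x else c.
have sigmaK t : eval sigma (rename Some t) = t.
  by rewrite eval_eval -[RHS]eval_Var.
(* By disjointness only the fresh variable is shared, so [sigma] turns the interpolant into closed
   terms. *)
have valZ (z : X `&` Y) : val z = None.
  have [[//|[x Gx xz]] [//|[y phiy yz]]] := set_valP z.
  have : (vars_set G `&` vars phi) x.
    by split=> //; have [<-] : Some y = Some x by rewrite xz yz.
  by rewrite XY0.
have sigmaZ (h : Fm S (X `&` Y)) : vars (eval sigma (rename val h)) = set0.
  rewrite eval_eval vars_eval; apply: bigcup0 => z _.
  by rewrite /= -[X in sigma X]/(val z) valZ.
have [] := @interpolation_shared_var _ X Y (rename Some @` G) (rename Some phi)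
  lifting.
- by exists None; split; left.
- move=> o [_ [g Gg <-] +]; rewrite vars_eval => -[x gx ->].
  by right; exists x => //; exists g.
- by rewrite vars_eval => _ [x phix ->]; right; exists x.
- exact: entails_subst.
move=> H [GH Hphi]; exists (eval sigma @` (rename val @` H)); split.
- by apply: bigcup0 => _ [_ [h _ <-] <-].
- move=> _ [_ [h Hh <-] <-]; apply: (entails_sub _ (entails_subst sigma (GH h Hh))).
  by move=> _ [_ [g Gg <-] <-]; rewrite sigmaK.
- by rewrite -(sigmaK phi); exact: entails_subst.
Qed.

Lemma theorem_of_disjoint_vars (V : Type) (G : set (Fm S V)) (phi : Fm S V) :
  vars_set G `&` vars phi = set0 -> (forall c : Fm S V, vars c <> set0) ->
  entails K tau G phi -> entails K tau set0 phi.
Proof.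
set X := vars_set G; set Y := vars phi => XY0 noc Gphi.
apply/entailsP => C v KC _.
(* A term without available variables would be closed. *)
have Z0 : Fm S (X `&` Y) -> False.
  move=> t; apply: (noc (rename val t)).
  by apply/seteqP; split=> x // xt; rewrite -XY0; exact: rename_val_vars xt.
(* Every equation holds in [U], so its only valuation satisfies [G]. *)
pose U : structure S := @Structure S unit (fun _ _ => tt).
have U1 (a b : U) : a = b by case: a b => [] [].
have [] := @amalgam_valuation V X Y (Fm S (X `&` Y)) U C (fun=> tt)
  (fun t => False_rect _ (Z0 t)) Var (fun=> tt) (v \o val).
- by apply: quasivariety_trivial => t; case: (Z0 t).
- exact: quasivariety_trivial.
- exact: KC.
- by split=> // t; case: (Z0 t).
- by split=> [f a|t]; [case: (Z0 (interp a))|case: (Z0 t)].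
- by move=> z; exact: U1.
- by move=> z; case: (Z0 (Var z)).
(* As [phi] is not closed, one of its variables makes the union nonempty. *)
- have /eqP/set0P[y Yy] := noc phi.
  by exists y; right.
move=> D [w [KD wX wY]].
have [phi' phi'E] := @rename_val_surj _ _ Y phi (fun _ => id).
have -> : eval v phi = eval (v \o val) phi' by rewrite -phi'E eval_eval.
rewrite -wY phi'E; apply: ((entailsP _ _).1 Gphi) => // g Gg.
have [g' <-] : exists g' : Fm S X, rename val g' = g.
  by apply: rename_val_surj => x xg; exists g.
by rewrite wX => e _; exact: U1.
Qed.

End Quasivariety.

(** * The three cases: a shared variable, a closed term, neither *)

Theorem theorem5p5 (S : signature) (K : class S) (tau : set (equation S unit))
  (K_sub : closed_under_subalgebras K)
  (filter_pair : equational_filter_pair K tau)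
  (lifting : theory_lifting K tau)
  (K_amalg : amalgamation K) :
  forall V : Type, craig_entailment_interpolation (@entails S K tau V).
Proof.
move=> V G phi Gphi; have [K_qv _] := filter_pair.
have [XY0|/eqP/set0P XY0] := pselect (vars_set G `&` vars phi = set0); last first.
  have [//|//|H [GH Hphi]] :=
    interpolation_shared_var K_qv K_amalg lifting XY0 _ _ Gphi.
  exists (rename val @` H); split=> // [x [_ [h _ <-]]|_ [h Hh <-]].
    exact: rename_val_vars.
  exact: GH.
have [[c c0]|noc] := pselect (exists c : Fm S V, vars c = set0).
  have [H [H0 GH Hphi]] :=
    interpolation_closed_term K_qv K_amalg lifting XY0 c0 Gphi.
  by exists H; rewrite H0; split.
(* Here [phi] is a theorem, so the empty set interpolates. *)
exists set0; split=> //; first by move=> x [].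
apply: theorem_of_disjoint_vars Gphi => // c c0; apply: noc; by exists c.
Qed.
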